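(* Let $m\ge1$ be an integer. For each integer $k\ge1$ let $s$ be the map $s(i)=ik$, $0\le i\le m$, let $E$ be the $(km+1)\times(m+1)$ degree elevation matrix from degree $m$ to degree $n=km$, and let $D^m_k=B^mA_k$ with $A_k=E(s,:)^{-1}$. Then $D^m_k\to L^m$ as $k\to\infty$, where $L^m=[L^m_0,\ldots,L^m_m]$ is the Lagrange basis of $\mathcal{P}_m$ at the points $i/m$, $0\le i\le m$; that is, for each $i$ the $i$-th entry of $D^m_k$ converges to $L^m_i$ in the finite-dimensional space $\mathcal{P}_m$.
   Context: $\mathcal{P}_m$ is the space of real polynomials of degree at most $m$ (with its unique norm topology). The Bernstein basis is the row vector $B^m=[B_0^m,\ldots,B_m^m]$, $B_i^m(t)=\binom{m}{i}(1-t)^{m-i}t^i$. The degree elevation matrix $E$ from degree $m$ to degree $n$ has entries $E(i,j)=\binom{n-i}{m-j}\binom{i}{j}/\binom{n}{m}$, $0\le i\le n$, $0\le j\le m$ (zero if $i<j$ or $n-i<m-j$). $E(s,:)$ is the $(m+1)\times(m+1)$ matrix with entries $E(s(i),j)$; it is invertible, and $D^m_k$ is the basis of $\mathcal{P}_m$ dual to the functionals $\lambda^{km}_{ik}$, $0\le i\le m$, where $\lambda_l^nf=\sum_{j=0}^l\frac{\binom{l}{j}}{\binom{n}{j}}\frac{1}{j!}f^{(j)}(0)$. The Lagrange basis satisfies $L^m_i(j/m)=\delta_{ij}$. *)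

(* Defs.v *)
From HB Require Import structures.
From mathcomp Require Import all_boot all_order all_algebra.
From mathcomp Require Import all_classical all_reals all_analysis.
From mathcomp Require Import zify.

Set Implicit Arguments.
Unset Strict Implicit.
Unset Printing Implicit Defensive.
Import Order.TTheory GRing.Theory Num.Theory.
Import numFieldNormedType.Exports.

Local Open Scope classical_set_scope.
Local Open Scope ring_scope.

(* The space of real polynomials of degree at most m is the vector space
   {poly_m.+1 R} of polynomials of size at most m + 1. *)

Definition is_norm (R : realType) (V : lmodType R) (N : V -> R) : Prop :=
  [/\ forall u v : V, N (u + v) <= N u + N v,
      forall (a : R) (v : V), N (a *: v) = `|a| * N v
    & forall v : V, N v = 0 -> v = 0].

(* The norm topology of a finite-dimensional space does not depend on the norm;
   accordingly no norm is singled out, and convergence is required for each. *)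
Definition cvg_all_norms (R : realType) (V : vectType R) (u : nat -> V) (l : V)
  : Prop :=
  forall N : V -> R, is_norm N -> N (u k - l) @[k --> \oo] --> (0 : R).

(* npolyp m.+1 p is p whenever size p <= m.+1, see bernsteinE. *)
Definition bernstein (R : realType) (m : nat) (i : 'I_m.+1) : {poly_m.+1 R} :=
  npolyp m.+1 ('C(m, i)%:R *: ((1 - 'X) ^+ (m - i) * 'X^i)).

(* The vanishing of E(i, j) for i < j or n - i < m - j comes from that of the
   binomial coefficients; the subtractions are never truncated. *)
Definition elevation_mx (R : realType) (m n : nat) : 'M[R]_(n.+1, m.+1) :=
  \matrix_(i < n.+1, j < m.+1)
    ('C(n - i, m - j)%:R * 'C(i, j)%:R / 'C(n, m)%:R).

Lemma node_proof (m k : nat) (i : 'I_m.+1) : (i * k < (k * m).+1)%N.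
Proof. by rewrite ltnS mulnC leq_mul2l -ltnS ltn_ord orbT. Qed.

Definition node (m k : nat) (i : 'I_m.+1) : 'I_(k * m).+1 :=
  Ordinal (node_proof k i).

Definition elevation_node_mx (R : realType) (m k : nat) : 'M[R]_m.+1 :=
  rowsub (@node m k) (elevation_mx R m (k * m)).

(* For k >= 1 the inverse is a genuine one, see elevation_node_mx_unit. *)
Definition dual_coef_mx (R : realType) (m k : nat) : 'M[R]_m.+1 :=
  invmx (elevation_node_mx R m k).

Definition dual_basis (R : realType) (m k : nat) (i : 'I_m.+1)
  : {poly_m.+1 R} :=
  \sum_(j < m.+1) dual_coef_mx R m k j i *: bernstein R j.

Definition lagrange_basis (R : realType) (m : nat) (i : 'I_m.+1)
  : {poly_m.+1 R} :=
  tnth (lagrange m.+1 (fun j : nat => j%:R / m%:R : R)) i.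

Lemma bernsteinE (R : realType) (m : nat) (i : 'I_m.+1) :
  bernstein R i = 'C(m, i)%:R *: ((1 - 'X) ^+ (m - i) * 'X^i) :> {poly R}.
Proof.
rewrite /bernstein npolypK //.
apply: (leq_trans (size_scale_leq _ _)).
apply: (leq_trans (size_polyMleq _ _)); rewrite size_polyXn addnS /=.
have im : (i <= m)%N by rewrite -ltnS.
have : (size ((1 - 'X : {poly R}) ^+ (m - i)) <= (m - i).+1)%N.
  apply: (leq_trans (size_poly_exp_leq _ _)); rewrite ltnS.
  rewrite -opprB size_polyN -polyC1 size_XsubC mul1n //.
by rewrite -(leq_add2r i) addSn subnK.
Qed.

Lemma lagrange_basis_node (R : realType) (m : nat) (i j : 'I_m.+1) :
  (0 < m)%N -> (lagrange_basis R i).[j%:R / m%:R] = (i == j)%:R.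
Proof.
move=> m_gt0.
apply: (@lagrange_sample R m.+1 (fun j : nat => j%:R / m%:R)) => // a b /=.
have m0 : m%:R != 0 :> R by rewrite pnatr_eq0 -lt0n.
by move=> /(mulIf (invr_neq0 m0)) /eqP; rewrite eqr_nat => /eqP.
Qed.

Lemma natr_ffact (R : realType) (x j : nat) :
  (x ^_ j)%:R = \prod_(l < j) (x%:R - l%:R) :> R.
Proof.
elim: j => [|j IHj]; first by rewrite big_ord0 ffactn0.
rewrite big_ord_recr /= -IHj ffactnSr natrM.
case: (leqP j x) => jx; first by rewrite natrB.
by rewrite ffact_small // !mul0r.
Qed.

Lemma natr_bin (R : realType) (x j : nat) :
  'C(x, j)%:R = (j`!%:R)^-1 * \prod_(l < j) (x%:R - l%:R) :> R.
Proof.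
by rewrite -natr_ffact -bin_ffact natrM mulrC mulfK //.
Qed.

Lemma size_prod_linear (R : realType) (a : nat) (p : nat -> {poly R}) :
  (forall l, (size (p l) <= 2)%N) -> (size (\prod_(l < a) p l)%R <= a.+1)%N.
Proof.
move=> szp; elim: a => [|a IHa]; first by rewrite big_ord0 size_poly1.
rewrite big_ord_recr /=; apply: (leq_trans (size_polyMleq _ _)).
by have := leq_add IHa (szp a); set u := size _; set w := size _; lia.
Qed.

Lemma elevation_node_mx_unit (R : realType) (m k : nat) :
  (0 < k)%N -> elevation_node_mx R m k \in unitmx.
Proof.
move=> k_gt0; set n := (k * m)%N.
have mn : (m <= n)%N by rewrite leq_pmull.
rewrite -unitmx_tr unitmxE unitfE; apply/negP => /det0P[v v0 vE].
pose pj (j : 'I_m.+1) : {poly R} :=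
  ((m - j)`!%:R)^-1 *: (\prod_(l < m - j) ((n%:R - l%:R)%:P - 'X)) *
  ((j`!%:R)^-1 *: \prod_(l < j) ('X - l%:R%:P)).
have pjE (j : 'I_m.+1) x : (x <= n)%N ->
    (pj j).[x%:R] = 'C(n - x, m - j)%:R * 'C(x, j)%:R.
  move=> xn; rewrite /pj hornerM !hornerZ !horner_prod !natr_bin natrB //.
  congr (_ * _ * (_ * _)); apply: eq_bigr => l _; rewrite !hornerE //.
  by rewrite addrAC.
pose q := \sum_j v 0 j *: pj j.
have qE x : (x <= n)%N ->
    q.[x%:R] = \sum_(j < m.+1) v 0 j * ('C(n - x, m - j)%:R * 'C(x, j)%:R).
  by move=> xn; rewrite horner_sum; apply: eq_bigr => j _; rewrite hornerZ pjE.
have Cnm : 'C(n, m)%:R != 0 :> R by rewrite pnatr_eq0 -lt0n bin_gt0.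
have szq : (size q <= m.+1)%N.
  apply: (leq_trans (size_sum _ _ _)); apply/bigmax_leqP => j _.
  apply: (leq_trans (size_scale_leq _ _)).
  apply: (leq_trans (size_polyMleq _ _)).
  have jm : (j <= m)%N by rewrite -ltnS.
  set p1 := (X in (size X + _)%N); set p2 := (X in (_ + size X)%N).
  have s1 : (size p1 <= (m - j).+1)%N.
    apply: (leq_trans (size_scale_leq _ _)).
    apply: (@size_prod_linear R _ (fun l => (n%:R - l%:R)%:P - 'X)) => l.
    by rewrite -size_polyN opprB size_XsubC.
  have s2 : (size p2 <= j.+1)%N.
    apply: (leq_trans (size_scale_leq _ _)).
    apply: (@size_prod_linear R _ (fun l => 'X - l%:R%:P)) => l.
    by rewrite size_XsubC.
  lia.
have q_node (i : 'I_m.+1) : q.[(i * k)%:R] = 0.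
  have ik : (i * k <= n)%N by rewrite -ltnS node_proof.
  have /rowP/(_ i) := vE; rewrite !mxE => vEi.
  apply: (mulIf (invr_neq0 Cnm)); rewrite mul0r -[RHS]vEi qE // mulr_suml.
  by apply: eq_bigr => j _; rewrite !mxE /= -!mulrA.
have q0 : q = 0.
  apply: (@roots_geq_poly_eq0 _ q [seq (i * k)%:R | i <- iota 0 m.+1]).
  - apply/allP => y /mapP[i]; rewrite mem_iota => /= im ->.
    by apply/rootP; rewrite (q_node (Ordinal im)).
  - rewrite map_inj_uniq ?iota_uniq // => a b /eqP.
    by rewrite eqr_nat eqn_pmul2r // => /eqP.
  - by rewrite size_map size_iota.
move/eqP: v0; apply; apply/rowP => j; rewrite mxE.
case: j => j; elim/ltn_ind: j => x IHx xm.
have xn : (x <= n)%N by rewrite (leq_trans _ mn) // -ltnS.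
have := qE x xn; rewrite q0 horner0 (bigD1 (Ordinal xm)) //= binn mulr1.
rewrite big1 ?addr0.
  move/esym/eqP; rewrite mulf_eq0 pnatr_eq0 -[_ == 0%N]leqn0 leqNgt bin_gt0.
  by rewrite leq_sub2r // orbF => /eqP.
move=> j; rewrite -val_eqE /= neq_ltn => /orP[jx|xj].
  by case: j jx => j jm /= jx; rewrite IHx // mul0r.
by rewrite (bin_small xj) !mulr0.
Qed.

(* Main.v *)
Require Import Defs.
From mathcomp Require Import all_boot all_order all_algebra.
From mathcomp Require Import all_classical all_reals all_analysis.
From mathcomp Require Import zify ring.

(** Since [B_j = \sum_l B_j(l/m) L_l], the basis [D_k] is [L] times [G A_k],
    where [G] is the matrix of values of the Bernstein basis at the points
    [l/m].  Entrywise [E(s,:)] tends to [G] as [k] tends to infinity, because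
    ['C(k a, j) / k^j] tends to [a^j / j!]; as [G] is invertible and inversion
    is continuous, [G A_k] tends to the identity. *)

Set Implicit Arguments.
Unset Strict Implicit.
Unset Printing Implicit Defensive.
Import Order.TTheory GRing.Theory Num.Theory.
Import numFieldNormedType.Exports.

Local Open Scope classical_set_scope.
Local Open Scope ring_scope.

Lemma cvg_sum_fin (R : realType) (I : finType) (u : I -> nat -> R)
    (a : I -> R) :
  (forall i, u i k @[k --> \oo] --> a i) ->
  \sum_i u i k @[k --> \oo] --> \sum_i a i.
Proof. by move=> ua; apply: cvg_big => //; exact: add_continuous. Qed.

Lemma cvg_prod_fin (R : realType) (I : finType) (u : I -> nat -> R)
    (a : I -> R) :
  (forall i, u i k @[k --> \oo] --> a i) ->
  \prod_i u i k @[k --> \oo] --> \prod_i a i.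
Proof. by move=> ua; apply: cvg_big => //; exact: mul_continuous. Qed.

Lemma cvg_det (R : realType) (n : nat) (M : nat -> 'M[R]_n) (A : 'M[R]_n) :
  (forall i j, M k i j @[k --> \oo] --> A i j) ->
  \det (M k) @[k --> \oo] --> \det A.
Proof.
move=> MA; rewrite /determinant; apply: cvg_sum_fin => s.
by apply: cvgMl_tmp; apply: cvg_prod_fin.
Qed.

(** Cramer's rule: for a unit matrix [invmx] is the adjugate divided by the determinant, and both
    are polynomial in the entries. *)
Lemma cvg_invmx (R : realType) (n : nat) (M : nat -> 'M[R]_n) (A : 'M[R]_n) :
  (forall k, M k \in unitmx) -> A \in unitmx ->
  (forall i j, M k i j @[k --> \oo] --> A i j) ->
  forall i j, invmx (M k) i j @[k --> \oo] --> invmx A i j.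
Proof.
move=> Mu Au MA i j; rewrite /invmx Au !mxE.
under eq_fun do rewrite Mu !mxE.
apply: cvgM; first by apply: cvgV (cvg_det MA); rewrite -unitfE -unitmxE.
apply: cvgMl_tmp; apply: cvg_det => a b; rewrite !mxE.
by under eq_fun do rewrite !mxE; exact: MA.
Qed.

(** Up to [j!], the binomial is a product of [j] linear factors; sharing the [j] powers of [k.+1]
    among them turns each into [a - l / k.+1]. *)
Lemma cvg_bin_scaled (R : realType) (a j : nat) :
  'C(k.+1 * a, j)%:R / k.+1%:R ^+ j @[k --> \oo]
    --> ((j`!%:R)^-1 * a%:R ^+ j : R).
Proof.
under eq_fun => k.
  rewrite natr_bin -mulrA -exprVn -[X in _ * (_ * _ ^+ X)]card_ord -prodr_const.
  rewrite -big_split /=; over.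
apply: cvgMl_tmp.
have -> : a%:R ^+ j = \prod_(l < j) a%:R :> R by rewrite prodr_const card_ord.
apply: cvg_prod_fin => l.
under eq_fun => k do rewrite natrM mulrBl mulrAC divff ?pnatr_eq0 // mul1r.
have : a%:R - l%:R * harmonic k @[k --> \oo] --> (a%:R - l%:R * 0 : R).
  by apply: cvgB (cvg_cst _) _; apply: cvgMl_tmp; exact: cvg_harmonic.
by rewrite mulr0 subr0.
Qed.

Definition bernstein_node_mx (R : realType) (m : nat) : 'M[R]_m.+1 :=
  \matrix_(l, j) (bernstein R j).[l%:R / m%:R].

Lemma bernstein_node_mx_unit (R : realType) (m : nat) :
  (0 < m)%N -> bernstein_node_mx R m \in unitmx.
Proof.
move=> m_gt0; rewrite -unitmx_tr unitmxE unitfE; apply/negP => /det0P[v v0 vE].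
have m0 : m%:R != 0 :> R by rewrite pnatr_eq0 -lt0n.
have vnode (l : nat) : (l <= m)%N -> \sum_(j < m.+1)
    v 0 j * ('C(m, j)%:R * ((1 - l%:R / m%:R) ^+ (m - j) * (l%:R / m%:R) ^+ j))
    = 0.
  rewrite -ltnS => lm; have /rowP/(_ (Ordinal lm)) := vE; rewrite !mxE => {2}<-.
  by apply: eq_bigr => j _; rewrite !mxE bernsteinE !hornerE.
(* At the last node, [x = 1], every Bernstein polynomial but the last vanishes. This node has no
   coordinate [y] and is treated apart. *)
have vmax : v 0 ord_max = 0.
  have := vnode m (leqnn m); rewrite big_ord_recr /= big1 => [|j _].
    by rewrite divff // subrr subnn expr0 expr1n binn !mulr1 add0r.
  by rewrite divff // subrr expr0n subn_eq0 leqNgt ltn_ord mul0r !mulr0.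
pose q : {poly R} := \poly_(j < m) (v 0 (inord j) * 'C(m, j)%:R).
(* In the coordinate [y = x / (1 - x)] the vanishing of [\sum_j v_j B_j] at the
   nodes [x < 1] says that [q], of degree less than [m], has [m] roots. *)
pose y (l : nat) : R := l%:R / (m - l)%:R.
have lm0 l : (l < m)%N -> (m - l)%:R != 0 :> R.
  by move=> lm; rewrite pnatr_eq0 subn_eq0 -ltnNge.
have q_y l : (l < m)%N -> q.[y l] = 0.
  move=> lm; have x0 := lm0 _ lm.
  have Ex : 1 - l%:R / m%:R = (m - l)%:R / m%:R :> R.
    by rewrite natrB 1?ltnW // mulrBl divff.
  have := vnode l (ltnW lm); rewrite big_ord_recr /= vmax mul0r addr0 Ex => vl.
  (* The factor is [(1 - x) ^+ m], nonzero at this node; it turns each [y ^+ j] into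
     [(1 - x) ^+ (m - j) * x ^+ j]. *)
  apply: (@mulIf _ (((m - l)%:R / m%:R) ^+ m)).
    by rewrite expf_neq0 // mulf_neq0 // invr_eq0.
  rewrite mul0r -[RHS]vl horner_poly mulr_suml; apply: eq_bigr => j _.
  have -> : inord j = widen_ord (leqnSn m) j.
    by apply: val_inj; rewrite /= inordK // ltnW // ltnS.
  have jm := ltnW (ltn_ord j).
  rewrite -!mulrA; congr (_ * (_ * _)).
  have -> (z : R) : z ^+ m = z ^+ (m - j) * z ^+ j by rewrite -exprD subnK.
  rewrite mulrCA -exprMn /y; congr (_ * _ ^+ _).
  by rewrite mulrA divfK.
have q0 : q = 0.
  apply: (@roots_geq_poly_eq0 _ q [seq y l | l <- iota 0 m]).
  - apply/allP => z /mapP[l]; rewrite mem_iota => /= lm ->.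
    by apply/rootP; exact: q_y.
  - rewrite map_inj_in_uniq ?iota_uniq // => a b; rewrite !mem_iota /= => am bm.
    (* Cross-multiplied, [y a = y b] reads [a (m - b) = b (m - a)], hence [a m = b m]. *)
    move/eqP; rewrite /y eqr_div ?lm0 // -!natrM eqr_nat => /eqP.
    by rewrite !mulnBr [(b * a)%N]mulnC => /eqP; nia.
  - by rewrite size_map size_iota size_poly.
move/eqP: v0; apply; apply/rowP => j; rewrite mxE.
have [jm|] := ltnP j m; last first.
  move=> mj; rewrite -vmax; congr (v 0 _); apply/val_inj/eqP.
  by rewrite eqn_leq mj -ltnS ltn_ord.
have := coef_poly m (fun j => v 0 (inord j) * 'C(m, j)%:R) j.
rewrite -/q q0 coef0 jm inord_val => /esym/eqP.
rewrite mulf_eq0 pnatr_eq0 -[_ == 0%N]leqn0 leqNgt bin_gt0 ltnW // orbF.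
by move/eqP.
Qed.

(** As [n - s(l) = k (m - l)], all three binomials of the entry have an upper index proportional to
    [k]. Scaled by [k ^+ (m - j)], [k ^+ j] and [k ^+ m], they converge separately, and these powers
    cancel in the quotient. *)
Lemma cvg_elevation_node_mx (R : realType) (m : nat) (l j : 'I_m.+1) :
  (0 < m)%N ->
  elevation_node_mx R m k.+1 l j @[k --> \oo] --> bernstein_node_mx R m l j.
Proof.
move=> m_gt0; have m0 : m%:R != 0 :> R by rewrite pnatr_eq0 -lt0n.
have lm : (l <= m)%N by rewrite -ltnS.
have jm : (j <= m)%N by rewrite -ltnS.
have f0 n : n`!%:R != 0 :> R by rewrite pnatr_eq0 -lt0n fact_gt0.
have cvgC := @cvg_bin_scaled R.
have : ('C(k.+1 * (m - l), m - j)%:R / k.+1%:R ^+ (m - j)) *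
    ('C(k.+1 * l, j)%:R / k.+1%:R ^+ j) / ('C(k.+1 * m, m)%:R / k.+1%:R ^+ m)
    @[k --> \oo] --> bernstein_node_mx R m l j.
  have -> : bernstein_node_mx R m l j =
      ((m - j)`!%:R^-1 * (m - l)%:R ^+ (m - j)) * (j`!%:R^-1 * l%:R ^+ j) /
      (m`!%:R^-1 * m%:R ^+ m).
    rewrite mxE bernsteinE hornerZ hornerM hornerXn horner_exp.
    rewrite hornerD hornerN hornerX -polyC1 hornerC.
    have -> : 1 - l%:R / m%:R = (m - l)%:R / m%:R :> R.
      by rewrite natrB // mulrBl divff.
    have -> : 'C(m, j)%:R = m`!%:R / (j`!%:R * (m - j)`!%:R) :> R.
      by rewrite -(bin_fact jm) !natrM mulfK ?mulf_neq0.
    have -> (z : R) : z ^+ m = z ^+ (m - j) * z ^+ j by rewrite -exprD subnK.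
    by rewrite !expr_div_n; field; rewrite !f0 !expf_neq0.
  apply: cvgM; first by apply: cvgM; exact: cvgC.
  by apply: cvgV (cvgC _ _); rewrite mulf_neq0 ?invr_eq0 ?expf_neq0.
apply: cvg_trans; apply: near_eq_cvg; apply: nearW => k.
rewrite !mxE /= [(l * _)%N]mulnC -mulnBr.
have k0 : k.+1%:R != 0 :> R by rewrite pnatr_eq0.
have C0 : 'C(k.+1 * m, m)%:R != 0 :> R.
  by rewrite pnatr_eq0 -lt0n bin_gt0 leq_pmull.
have -> (z : R) : z ^+ m = z ^+ (m - j) * z ^+ j by rewrite -exprD subnK.
by field; rewrite C0 !expf_neq0.
Qed.

Lemma lagrange_interpolation (R : realType) (m : nat) (p : {poly_m.+1 R}) :
  (0 < m)%N -> p = \sum_(l < m.+1) p.[l%:R / m%:R] *: lagrange_basis R l.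
Proof.
move=> m_gt0; have m0 : m%:R != 0 :> R by rewrite pnatr_eq0 -lt0n.
have x_inj : injective (fun j : nat => j%:R / m%:R : R).
  by move=> a b /(mulIf (invr_neq0 m0)) /eqP; rewrite eqr_nat => /eqP.
rewrite [LHS](coord_basis (lagrange_full _ x_inj)) ?memvf //.
by apply: eq_bigr => l _; rewrite lagrange_coords // nth_lagrange.
Qed.

Lemma dual_basisE (R : realType) (m k : nat) (i : 'I_m.+1) : (0 < m)%N ->
  dual_basis R k i =
  \sum_l (bernstein_node_mx R m *m dual_coef_mx R m k) l i *:
    lagrange_basis R l.
Proof.
move=> m_gt0; rewrite /dual_basis.
under eq_bigr => j _ do
  rewrite [bernstein R j](lagrange_interpolation _ m_gt0) scaler_sumr.
rewrite exchange_big /=; apply: eq_bigr => l _.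
rewrite !mxE scaler_suml; apply: eq_bigr => j _.
by rewrite scalerA mxE mulrC.
Qed.

Lemma is_norm_sum_le (R : realType) (V : lmodType R) (N : V -> R) (I : finType)
    (a : I -> R) (v : I -> V) :
  is_norm N -> N (\sum_i a i *: v i) <= \sum_i `|a i| * N (v i).
Proof.
case=> ND NZ _; elim/big_ind2: _ => [|x1 x2 y1 y2 le1 le2|i _].
- by rewrite -(scale0r 0) NZ normr0 mul0r.
- by apply: le_trans (ND _ _) _; apply: lerD.
- by rewrite NZ.
Qed.

(** Nonnegativity is not among the clauses of [is_norm]; it follows from
    [0 = N (v - v) <= N v + N v]. *)
Lemma is_norm_ge0 (R : realType) (V : lmodType R) (N : V -> R) (v : V) :
  is_norm N -> 0 <= N v.
Proof.
case=> ND NZ _; have := ND v (- v).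
rewrite subrr -(scale0r v) NZ normr0 mul0r -scaleN1r NZ normrN1 mul1r.
by rewrite -mulr2n pmulrn_lge0.
Qed.

Theorem corollary6p3 (R : realType) (m : nat) (hm : (0 < m)%N)
    (i : 'I_m.+1) :
  cvg_all_norms (fun k : nat => dual_basis R k i) (lagrange_basis R i).
Proof.
(* The index is shifted because invertibility of the node matrix is only known for [k >= 1]. *)
move=> N normN; rewrite -cvg_shiftS /=.
set G := bernstein_node_mx R m.
have Gu : G \in unitmx by exact: bernstein_node_mx_unit.
(* The Lagrange coordinates of the error: column [i] of [G A_k - 1], at the shifted index. *)
pose c k (l : 'I_m.+1) := (G *m dual_coef_mx R m k.+1) l i -
  (1%:M : 'M[R]_m.+1) l i.
have c0 l : c k l @[k --> \oo] --> 0.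
  rewrite -(subrr ((1%:M : 'M[R]_m.+1) l i)).
  apply: cvgB; last exact: cvg_cst.
  rewrite -(mulmxV Gu) mxE.
  under eq_fun do rewrite mxE.
  apply: cvg_sum_fin => j; apply: cvgMl_tmp.
  apply: (cvg_invmx (M := fun k => elevation_node_mx R m k.+1)) => //.
    by move=> k; exact: elevation_node_mx_unit.
  by move=> a b; exact: cvg_elevation_node_mx.
have dE k : dual_basis R k.+1 i - lagrange_basis R i =
    \sum_l c k l *: lagrange_basis R l.
  rewrite dual_basisE // /c; under [RHS]eq_bigr do rewrite scalerBl.
  rewrite sumrB; congr (_ - _).
  rewrite (bigD1 i) //= big1 => [|l /negPf li]; rewrite !mxE.
    by rewrite eqxx scale1r addr0.
  by rewrite li scale0r.
(* The numbers [N (lagrange_basis R l)] do not depend on [k], so convergence of the coordinates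
   suffices whatever the norm [N]. *)
apply: (@squeeze_cvgr _ _ _ _ (fun=> 0)
  (fun k => \sum_l `|c k l| * N (lagrange_basis R l))).
- apply: nearW => k; rewrite is_norm_ge0 //= dE; exact: is_norm_sum_le.
- exact: cvg_cst.
- have : \sum_l `|c k l| * N (lagrange_basis R l) @[k --> \oo]
      --> \sum_l `|0 : R| * N (lagrange_basis R l).
    by apply: cvg_sum_fin => l; apply: cvgMr_tmp; apply: cvg_norm.
  by rewrite big1 // => l _; rewrite normr0 mul0r.
Qed.
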